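(* Let $B(0,x):=\sum_{n=0}^\infty\frac{x^n}{n!\,n!}$. Then for every $x\in\mathbb{C}$, $$\sum_{n=0}^\infty \frac{\sqrt n}{n!}\,\frac{x^n}{n!}=\frac{1}{2\sqrt\pi}\int_0^1\left[B(0,x)-B(0,xv)\right]\frac{dv}{v(-\ln v)^{3/2}}.$$ *)

(* Defs.v *)
From Stdlib Require Import Reals Factorial Lra.
From Coquelicot Require Import Coquelicot.
Open Scope R_scope.

(* Coquelicot's [Series] is for real terms only.  As with [Series], the value is
   meaningful only when [ex_series a] holds. *)
Definition CSeries (a : nat -> C) : C :=
  iota (T := C_CompleteNormedModule) (fun l : C => is_series a l).

Lemma CSeries_unique (a : nat -> C) (l : C) : is_series a l -> CSeries a = l.
Proof.
  intros H. apply (iota_filterlim_locally (sum_n a) l). exact H.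
Qed.

Definition B0_term (x : C) (n : nat) : C :=
  (Cpow x n / RtoC (INR (fact n) * INR (fact n)))%C.

(* The function x |-> B(0,x); it is entire, see [ex_series_B0_term]. *)
Definition B0 (x : C) : C := CSeries (B0_term x).

Lemma ex_series_B0_term (x : C) : ex_series (B0_term x).
Proof.
  apply (ex_series_le (K := C_AbsRing) (V := C_CompleteNormedModule) _
           (fun n => Cmod x ^ n * / INR (fact n))).
  - intros n. change (Cmod (B0_term x n) <= Cmod x ^ n * / INR (fact n)).
    assert (Hf : 1 <= INR (fact n)).
    { replace 1 with (INR 1) by reflexivity. apply le_INR, lt_O_fact. }
    unfold B0_term.
    assert (Hp : 0 < INR (fact n) * INR (fact n)) by nra.
    rewrite Cmod_div by (intros E; apply RtoC_inj in E; lra).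
    rewrite Cmod_R, Rabs_pos_eq by lra.
    rewrite Cmod_pow. unfold Rdiv.
    apply Rmult_le_compat_l; [apply pow_le, Cmod_ge_0|].
    apply Rinv_le_contravar; nra.
  - exists (exp (Cmod x)).
    generalize (is_exp_Reals (Cmod x)). apply is_series_ext.
    intros n. rewrite pow_n_pow. reflexivity.
Qed.

Lemma is_series_B0 (x : C) : is_series (B0_term x) (B0 x).
Proof.
  destruct (ex_series_B0_term x) as [l Hl].
  unfold B0. rewrite (CSeries_unique _ _ Hl). exact Hl.
Qed.

Definition sqrt_term (x : C) (n : nat) : C :=
  (RtoC (sqrt (INR n) / INR (fact n)) * (Cpow x n / RtoC (INR (fact n))))%C.

Definition integrand (x : C) (v : R) : C :=
  ((B0 x - B0 (x * RtoC v)) / RtoC (v * Rpower (- ln v) (3 / 2)))%C.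

(* Main.v *)
Require Import Defs.
From Stdlib Require Import Reals Factorial Lra Lia FunctionalExtensionality.
From Coquelicot Require Import Coquelicot.
Open Scope R_scope.

(** Expanding B(0,x) - B(0,xv) in powers of x, the identity is, term by term,
    the evaluation

      int_0^1 (1 - v^n) / (v (-ln v)^(3/2)) dv = 2 sqrt (pi n),

    multiplied by x^n / (n!)^2 and summed over n.

    For the evaluation, substitute v = exp(-s^2) and integrate by parts.  With
    E(y) = int_0^y exp(-u^2) du, the function

      Phi(y) = 4 E(y) - 2 (1 - exp(-y^2)) / y

    has derivative 2 (1 - exp(-y^2)) / y^2, so that
    - sqrt n * Phi (sqrt n * sqrt (-ln v)) is an explicit antiderivative on
    (0,1) (is_derive_prim).  It tends to 0 at v = 1, and at v = 0 it tends to
    - sqrt n * Phi(+oo), where Phi(+oo) = 2 sqrt pi is four times the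
    Gaussian integral over the half-line (is_lim_gauss_prim).

    The sum is exchanged with the improper integral in two steps, both by
    uniform convergence (uniform_cv_series).  On a segment [a,b] inside (0,1)
    the integrand is a uniformly convergent series, which gives its integral
    from a to b as a series in the antiderivatives (is_RInt_integrand).  Because
    Phi is bounded, the antiderivatives are bounded by a constant times sqrt n on
    the whole line, so this second series converges uniformly in the pair (a, b), and
    the limits a -> 0 and b -> 1 may be taken termwise (is_RInt_gen_integrand). *)

(** * The Gaussian integral *)

Definition gauss_prim (y : R) : R := RInt (fun u => exp (- (u * u))) 0 y.

Lemma ex_RInt_gauss (a b : R) : ex_RInt (fun u => exp (- (u * u))) a b.
Proof.
  apply (ex_RInt_continuous (V := R_CompleteNormedModule)).
  intros z _. apply (ex_derive_continuous (V := R_NormedModule)). auto_derive. exact I.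
Qed.

Lemma is_derive_gauss_prim (y : R) :
  is_derive gauss_prim y (exp (- (y * y))).
Proof.
  apply (is_derive_RInt (V := R_NormedModule) (fun u => exp (- (u * u)))
           gauss_prim 0 y).
  - apply filter_forall; intros b. apply (RInt_correct (V := R_CompleteNormedModule)).
    apply ex_RInt_gauss.
  - apply (ex_derive_continuous (V := R_NormedModule)). auto_derive. exact I.
Qed.

Lemma gauss_prim_0 : gauss_prim 0 = 0.
Proof. exact (RInt_point (V := R_CompleteNormedModule) 0 _). Qed.

Lemma gauss_prim_ge0 (y : R) : 0 <= y -> 0 <= gauss_prim y.
Proof.
  intros Hy. apply RInt_ge_0; [exact Hy| |].
  - apply ex_RInt_gauss.
  - intros u _. left. apply exp_pos.
Qed.

(** The integral [gauss_rest x] of this function of t over [0,1] is the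
    classical companion of the Gaussian primitive: the square of the primitive
    plus [gauss_rest] is constant. *)
Definition gauss_rest_fun (x t : R) : R :=
  exp (- (x * x * (1 + t * t))) / (1 + t * t).

Definition gauss_rest (x : R) : R := RInt (gauss_rest_fun x) 0 1.

Lemma one_plus_sqr_pos (t : R) : 0 < 1 + t * t.
Proof. nra. Qed.

Lemma ex_RInt_gauss_rest (x : R) : ex_RInt (gauss_rest_fun x) 0 1.
Proof.
  apply (ex_RInt_continuous (V := R_CompleteNormedModule)).
  intros z _. apply (ex_derive_continuous (V := R_NormedModule)).
  unfold gauss_rest_fun. auto_derive. generalize (one_plus_sqr_pos z). lra.
Qed.

Lemma is_derive_gauss_rest_fun (t x : R) :
  is_derive (fun z => gauss_rest_fun z t) x
    (- 2 * x * exp (- (x * x * (1 + t * t)))).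
Proof.
  unfold gauss_rest_fun. generalize (one_plus_sqr_pos t); intros Ht.
  auto_derive; [lra|]. field. lra.
Qed.

(** Differentiating under the integral sign cancels the denominator 1 + t^2, and
    the remaining integral becomes the Gaussian primitive after the linear
    substitution u = x t. *)
Lemma is_derive_gauss_rest (x : R) :
  is_derive gauss_rest x (- 2 * exp (- (x * x)) * gauss_prim x).
Proof.
  assert (H := is_derive_RInt_param gauss_rest_fun 0 1 x).
  unfold gauss_rest.
  replace (- 2 * exp (- (x * x)) * gauss_prim x)
    with (RInt (fun t => Derive (fun u => gauss_rest_fun u t) x) 0 1).
  - apply H.
    + apply filter_forall. intros y t _. eexists. apply is_derive_gauss_rest_fun.
    + intros t _.
      apply (continuity_2d_pt_ext (fun u v => - 2 * u * exp (- (u * u * (1 + v * v))))).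
      * intros u v. symmetry. apply is_derive_unique, is_derive_gauss_rest_fun.
      * apply continuity_2d_pt_mult.
        -- apply continuity_2d_pt_mult; [apply continuity_2d_pt_const|apply continuity_2d_pt_id1].
        -- apply (continuity_1d_2d_pt_comp exp (fun u v => - (u * u * (1 + v * v)))).
           ++ apply derivable_continuous_pt, derivable_pt_exp.
           ++ apply continuity_2d_pt_opp.
              repeat (apply continuity_2d_pt_mult || apply continuity_2d_pt_plus ||
                      apply continuity_2d_pt_const || apply continuity_2d_pt_id1 ||
                      apply continuity_2d_pt_id2).
    + apply filter_forall. apply ex_RInt_gauss_rest.
  - rewrite (RInt_ext _ (fun t => scal (- 2 * exp (- (x * x)))
               (scal x (exp (- ((x * t + 0) * (x * t + 0))))))).
    + rewrite (RInt_scal (V := R_CompleteNormedModule)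
                (fun t => scal x (exp (- ((x * t + 0) * (x * t + 0)))))).
      * assert (Hc := RInt_comp_lin (V := R_CompleteNormedModule)
                        (fun u => exp (- (u * u))) x 0 0 1).
        rewrite !Rplus_0_r, Rmult_0_r, Rmult_1_r in Hc.
        unfold gauss_prim. rewrite <- Hc; [reflexivity|].
        apply ex_RInt_gauss.
      * apply (ex_RInt_continuous (V := R_CompleteNormedModule)).
        intros z _. apply (ex_derive_continuous (V := R_NormedModule)).
        unfold scal; simpl; unfold mult; simpl. auto_derive. exact I.
    + intros t _. etransitivity; [apply is_derive_unique, is_derive_gauss_rest_fun|].
      unfold scal; simpl; unfold mult; simpl.
      replace (- (x * x * (1 + t * t)))
        with (- (x * x) + - ((x * t + 0) * (x * t + 0))) by ring.
      rewrite exp_plus. ring.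
Qed.

Lemma gauss_rest_0 : gauss_rest 0 = PI / 4.
Proof.
  apply is_RInt_unique. replace (PI / 4) with (minus (atan 1) (atan 0)).
  - apply (is_RInt_derive (V := R_CompleteNormedModule) atan).
    + intros t _. unfold gauss_rest_fun. generalize (one_plus_sqr_pos t); intros Ht.
      auto_derive; [exact I|].
      replace (- (0 * 0 * (1 + t * t))) with 0 by ring. rewrite exp_0. field. nra.
    + intros t _. apply (ex_derive_continuous (V := R_NormedModule)).
      unfold gauss_rest_fun. auto_derive. generalize (one_plus_sqr_pos t). lra.
  - rewrite atan_1, atan_0. unfold minus, plus, opp; simpl. ring.
Qed.

(** The two sides have the same value at 0 and the derivatives of [gauss_prim]
    squared and of [gauss_rest] are opposite. *)
Lemma gauss_prim_sqr (y : R) :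
  0 <= y -> gauss_prim y * gauss_prim y = PI / 4 - gauss_rest y.
Proof.
  intros Hy. destruct (Req_dec y 0) as [->|Hy0].
  - rewrite gauss_prim_0, gauss_rest_0. ring.
  - assert (H : gauss_prim 0 * gauss_prim 0 + gauss_rest 0
              = gauss_prim y * gauss_prim y + gauss_rest y).
    { apply (eq_is_derive (fun y => gauss_prim y * gauss_prim y + gauss_rest y)); [|lra].
      intros t _.
      replace (@zero R_NormedModule)
        with (plus (exp (- (t * t)) * gauss_prim t + gauss_prim t * exp (- (t * t)))
                   (- 2 * exp (- (t * t)) * gauss_prim t))
        by (unfold plus, zero; simpl; ring).
      apply (is_derive_plus (V := R_NormedModule)).
      - apply (is_derive_mult (K := R_AbsRing) gauss_prim gauss_prim).
        + apply is_derive_gauss_prim.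
        + apply is_derive_gauss_prim.
        + intros; apply Rmult_comm.
      - apply is_derive_gauss_rest. }
    rewrite gauss_prim_0, gauss_rest_0 in H. lra.
Qed.

(** The exponential decay is weakened to 1/y, which is enough for the limit at
    infinity and follows from 1 + z <= exp z. *)
Lemma gauss_rest_bounds (y : R) : 0 < y -> 0 <= gauss_rest y <= / y.
Proof.
  intros Hy. split.
  - apply RInt_ge_0; [lra|apply ex_RInt_gauss_rest|].
    intros t _. unfold gauss_rest_fun.
    generalize (one_plus_sqr_pos t) (exp_pos (- (y * y * (1 + t * t)))); intros.
    apply Rlt_le, Rdiv_lt_0_compat; assumption.
  - replace (/ y) with (RInt (fun _ => / y) 0 1)
      by (rewrite RInt_const; unfold scal; simpl; unfold mult; simpl; ring).
    apply RInt_le; [lra|apply ex_RInt_gauss_rest|apply ex_RInt_const|].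
    intros t _. unfold gauss_rest_fun.
    rewrite exp_Ropp. set (e := exp _).
    assert (He : 1 + y * y * (1 + t * t) <= e) by (apply Rlt_le, exp_ineq1; nra).
    unfold Rdiv. rewrite <- Rinv_mult. apply Rinv_le_contravar; [lra|].
    assert (0 <= y * y * (t * t)) by (apply Rmult_le_pos; apply Rle_0_sqr).
    assert (0 <= t * t) by apply Rle_0_sqr.
    assert (y <= e) by nra. nra.
Qed.

Lemma gauss_prim_le (y : R) : 0 <= y -> gauss_prim y <= sqrt PI / 2.
Proof.
  intros Hy. destruct (Req_dec y 0) as [->|Hy0].
  - rewrite gauss_prim_0. generalize (sqrt_pos PI). lra.
  - assert (H := gauss_prim_sqr y Hy). assert (H1 := gauss_rest_bounds y).
    assert (H2 := gauss_prim_ge0 y Hy). assert (H3 := sqrt_sqrt PI).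
    generalize (sqrt_pos PI) PI_RGT_0. intros. nra.
Qed.

Lemma is_lim_gauss_prim : is_lim gauss_prim p_infty (sqrt PI / 2).
Proof.
  assert (Hs : sqrt PI / 2 = sqrt (PI / 4)).
  { rewrite sqrt_div_alt by lra. replace 4 with (2 * 2) by ring.
    rewrite sqrt_square by lra. reflexivity. }
  apply (is_lim_ext_loc (fun y => sqrt (PI / 4 - gauss_rest y))).
  - exists 0. intros y Hy. rewrite <- gauss_prim_sqr by lra.
    apply sqrt_square, gauss_prim_ge0. lra.
  - rewrite Hs. apply (filterlim_comp _ _ _ (fun y => PI / 4 - gauss_rest y) sqrt
                        _ (locally (PI / 4))); [|apply continuous_sqrt].
    assert (Hl : is_lim (fun y => PI / 4 - gauss_rest y) p_infty (PI / 4 - 0)).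
    { apply is_lim_minus'; [apply is_lim_const|].
      apply (is_lim_le_le_loc (fun _ => 0) (fun y => / y)).
      - exists 0. intros y Hy. apply gauss_rest_bounds, Hy.
      - apply is_lim_const.
      - apply (is_lim_inv (fun y => y) p_infty p_infty); [apply is_lim_id|discriminate]. }
    rewrite Rminus_0_r in Hl. exact Hl.
Qed.

(** * The antiderivative of (1 - v^n) / (v (-ln v)^(3/2)) *)

(** The integral of 2 (1 - exp(-u^2)) / u^2 from 0 to y, in the form that
    integration by parts gives.  The numerator of the quotient vanishes at
    y = 0, so the formula gives the right value 0 there too. *)
Definition Phi (y : R) : R :=
  4 * gauss_prim y - 2 * (1 - exp (- (y * y))) / y.

Lemma Phi_0 : Phi 0 = 0.
Proof.
  unfold Phi. rewrite gauss_prim_0. replace (- (0 * 0)) with 0 by ring.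
  rewrite exp_0. unfold Rdiv. ring.
Qed.

Lemma is_derive_Phi (y : R) :
  0 < y -> is_derive Phi y (2 * (1 - exp (- (y * y))) / (y * y)).
Proof.
  intros Hy.
  replace (2 * (1 - exp (- (y * y))) / (y * y)) with
    (minus (4 * exp (- (y * y)))
           (4 * exp (- (y * y)) - 2 * (1 - exp (- (y * y))) / (y * y)))
    by (unfold minus, plus, opp; simpl; ring).
  apply (is_derive_minus (V := R_NormedModule) (fun y => 4 * gauss_prim y)).
  - apply is_derive_scal, is_derive_gauss_prim.
  - auto_derive; [lra|]. field. lra.
Qed.

(** The bound y serves near 0, and the bound 1/y at infinity. *)
Lemma gauss_quotient_bounds (y : R) :
  0 < y -> 0 <= (1 - exp (- (y * y))) / y <= Rmin y (/ y).
Proof.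
  intros Hy. assert (0 < y * y) by nra. assert (Hi := Rinv_0_lt_compat y Hy).
  assert (He := exp_ineq1_le (- (y * y))). assert (He' := exp_pos (- (y * y))).
  assert (He1 : exp (- (y * y)) < 1) by (rewrite <- exp_0; apply exp_increasing; lra).
  split; [apply Rlt_le, Rdiv_lt_0_compat; lra|].
  apply Rmin_glb.
  - apply Rmult_le_reg_r with y; [exact Hy|].
    unfold Rdiv. rewrite Rmult_assoc, Rinv_l by lra. lra.
  - unfold Rdiv. nra.
Qed.

(** This bound on the whole half-line is what makes the antiderivatives [prim n]
    below bounded by a multiple of sqrt n, uniformly in v. *)
Lemma Phi_bound (y : R) : 0 <= y -> Rabs (Phi y) <= 2 * sqrt PI + 2.
Proof.
  intros Hy. assert (HP := sqrt_pos PI). destruct (Req_dec y 0) as [->|Hy0].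
  - rewrite Phi_0, Rabs_R0. lra.
  - assert (H1 := gauss_prim_le y Hy). assert (H2 := gauss_prim_ge0 y Hy).
    assert (H3 := gauss_quotient_bounds y ltac:(lra)).
    assert (Hm : Rmin y (/ y) <= 1).
    { destruct (Rle_dec y 1) as [h|h].
      - apply Rle_trans with (1 := Rmin_l _ _), h.
      - apply Rle_trans with (1 := Rmin_r _ _). rewrite <- Rinv_1.
        apply Rinv_le_contravar; lra. }
    unfold Phi. unfold Rdiv in *. rewrite Rmult_assoc. apply Rabs_le. lra.
Qed.

Lemma is_lim_Phi : is_lim Phi p_infty (2 * sqrt PI).
Proof.
  replace (2 * sqrt PI) with (4 * (sqrt PI / 2) - 2 * 0) by field.
  apply (is_lim_ext (fun y => 4 * gauss_prim y - 2 * ((1 - exp (- (y * y))) / y))).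
  { intros y. unfold Phi, Rdiv. ring. }
  apply is_lim_minus'.
  - apply (is_lim_scal_l gauss_prim 4 p_infty (sqrt PI / 2)), is_lim_gauss_prim.
  - apply (is_lim_scal_l _ 2 p_infty 0).
    apply (is_lim_le_le_loc (fun _ => 0) (fun y => / y)).
    + exists 0. intros y Hy. assert (H := gauss_quotient_bounds y Hy).
      generalize (Rmin_r y (/ y)). lra.
    + apply is_lim_const.
    + apply (is_lim_inv (fun y => y) p_infty p_infty); [apply is_lim_id|discriminate].
Qed.

Lemma continuous_Phi_0 : continuous Phi 0.
Proof.
  unfold Phi.
  apply (continuous_minus (V := R_NormedModule) (fun y => 4 * gauss_prim y)).
  - apply (continuous_mult (K := R_AbsRing) (fun _ => 4) gauss_prim); [apply continuous_const|].
    apply (ex_derive_continuous (V := R_NormedModule)).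
    eexists. apply is_derive_gauss_prim.
  - apply filterlim_locally. intros eps.
    assert (He : 0 < eps / 2) by (generalize (cond_pos eps); lra).
    exists (mkposreal _ He). intros y Hy.
    change (Rabs (y - 0) < eps / 2) in Hy.
    change (Rabs (2 * (1 - exp (- (y * y))) / y - 2 * (1 - exp (- (0 * 0))) / 0) < eps).
    replace (- (0 * 0)) with 0 by ring. rewrite exp_0.
    rewrite Rminus_0_r in Hy.
    replace (2 * (1 - exp (- (y * y))) / y - 2 * (1 - 1) / 0)
      with (2 * ((1 - exp (- (y * y))) / y)) by (unfold Rdiv; ring).
    rewrite Rabs_mult, (Rabs_pos_eq 2) by lra.
    enough (Rabs ((1 - exp (- (y * y))) / y) <= Rabs y) by lra.
    destruct (Rtotal_order y 0) as [h|[->|h]].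
    (* the quotient is odd in y *)
    + assert (H := gauss_quotient_bounds (- y) ltac:(lra)).
      generalize (Rmin_l (- y) (/ - y)); intros Hm.
      replace (- y * - y) with (y * y) in H by ring.
      rewrite Rdiv_opp_r in H. rewrite (Rabs_left1 y), Rabs_left1; lra.
    + unfold Rdiv. replace (- (0 * 0)) with 0 by ring. rewrite exp_0.
      rewrite Rminus_diag, Rmult_0_l. lra.
    + assert (H := gauss_quotient_bounds y h). generalize (Rmin_l y (/ y)); intros Hm.
      rewrite !Rabs_pos_eq; lra.
Qed.

(** The denominator of [integrand]. *)
Definition weight (v : R) : R := v * Rpower (- ln v) (3 / 2).

(** The variable sqrt n * s, where v = exp(-s^2), absorbs n: the antiderivatives
    for all n come from the single function [Phi]. *)
Definition prim (n : nat) (v : R) : R :=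
  - (sqrt (INR n) * Phi (sqrt (INR n) * sqrt (- ln v))).

Lemma weight_sqrt (v : R) : 0 < v < 1 ->
  weight v = v * (sqrt (- ln v) * sqrt (- ln v) * sqrt (- ln v)).
Proof.
  intros Hv. assert (Hl : ln v < 0) by (rewrite <- ln_1; apply ln_increasing; lra).
  unfold weight. f_equal. rewrite sqrt_sqrt by lra.
  replace (3 / 2) with (1 + / 2) by field.
  rewrite Rpower_plus, Rpower_1, Rpower_sqrt by lra. reflexivity.
Qed.

Lemma is_derive_prim (n : nat) (v : R) : 0 < v < 1 ->
  is_derive (prim n) v ((1 - v ^ n) / weight v).
Proof.
  intros Hv. assert (Hl : ln v < 0) by (rewrite <- ln_1; apply ln_increasing; lra).
  rewrite weight_sqrt by assumption.
  assert (Hs : 0 < sqrt (- ln v)) by (apply sqrt_lt_R0; lra).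
  unfold prim. destruct (Nat.eq_dec n 0) as [->|Hn].
  - simpl. apply (is_derive_ext (fun _ => 0)).
    + intros t. rewrite sqrt_0.
      change (0 = - (0 * Phi (0 * sqrt (- ln t))) :> R). ring.
    + unfold Rminus, Rdiv. rewrite Rplus_opp_r, Rmult_0_l. apply @is_derive_const.
  - assert (Hn' : 0 < INR n) by (apply lt_0_INR; lia).
    assert (Hr : 0 < sqrt (INR n)) by (apply sqrt_lt_R0; lra).
    set (r := sqrt (INR n)) in *. set (s := sqrt (- ln v)) in *.
    assert (Hrr : r * r = INR n) by (apply sqrt_sqrt; lra).
    assert (Hss : s * s = - ln v) by (apply sqrt_sqrt; lra).
    assert (Hv_pow : exp (- (r * s * (r * s))) = v ^ n).
    { rewrite <- (exp_ln (v ^ n)) by (apply pow_lt; lra).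
      rewrite ln_pow by lra. f_equal.
      replace (r * s * (r * s)) with ((r * r) * (s * s)) by ring.
      rewrite Hrr, Hss. ring. }
    (* the chain rule: - 1 / (2 s v) is the derivative of s = sqrt (- ln v) *)
    replace ((1 - v ^ n) / (v * (s * s * s))) with
      (opp (r * ((r * - (/ v) / (2 * s)) *
              (2 * (1 - exp (- (r * s * (r * s)))) / (r * s * (r * s)))))).
    + apply (is_derive_opp (V := R_NormedModule)
               (fun v => r * Phi (r * sqrt (- ln v)))).
      apply is_derive_scal.
      apply (is_derive_comp (V := R_NormedModule) Phi (fun v => r * sqrt (- ln v))).
      * apply is_derive_Phi. fold s. nra.
      * unfold s. auto_derive; [lra|]. fold s. field. lra.
    + rewrite Hv_pow. unfold opp; simpl. field. lra.
Qed.

(** Uniform convergence is used over all pairs of reals (a, b), so v must range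
    over R: outside (0,1) the total logarithm and square root still give [Phi] a
    nonnegative argument. *)
Lemma prim_bound (n : nat) (v : R) :
  Rabs (prim n v) <= sqrt (INR n) * (2 * sqrt PI + 2).
Proof.
  unfold prim. rewrite Rabs_Ropp, Rabs_mult, (Rabs_pos_eq (sqrt (INR n))) by apply sqrt_pos.
  apply Rmult_le_compat_l; [apply sqrt_pos|]. apply Phi_bound.
  apply Rmult_le_pos; apply sqrt_pos.
Qed.

Lemma filterlim_prim_1 (n : nat) : filterlim (prim n) (at_left 1) (locally 0).
Proof.
  intros P HP. apply filter_le_within. revert P HP.
  change (filterlim (prim n) (locally 1) (locally 0)).
  assert (H1 : prim n 1 = 0) by (unfold prim; rewrite ln_1, Ropp_0, sqrt_0, Rmult_0_r, Phi_0; ring).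
  rewrite <- H1. change (continuous (prim n) 1).
  unfold prim.
  apply (continuous_opp (V := R_NormedModule)).
  apply (continuous_mult (K := R_AbsRing) (fun _ => sqrt (INR n))); [apply continuous_const|].
  apply (continuous_comp (fun v => sqrt (INR n) * sqrt (- ln v)) Phi).
  - apply (continuous_mult (K := R_AbsRing) (fun _ => sqrt (INR n))); [apply continuous_const|].
    apply (continuous_comp (fun v => - ln v) sqrt); [|apply continuous_sqrt].
    apply (continuous_opp (V := R_NormedModule) ln).
    apply (ex_derive_continuous (V := R_NormedModule)). auto_derive. lra.
  - rewrite ln_1, Ropp_0, sqrt_0, Rmult_0_r. apply continuous_Phi_0.
Qed.

Lemma filterlim_prim_0 (n : nat) :
  filterlim (prim n) (at_right 0) (locally (- (sqrt (INR n) * (2 * sqrt PI)))).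
Proof.
  unfold prim. destruct (Nat.eq_dec n 0) as [->|Hn].
  - simpl. rewrite sqrt_0. apply (filterlim_ext (fun _ => - (0 * (2 * sqrt PI)))).
    + intros v. ring.
    + apply filterlim_const.
  - assert (Hr : 0 < sqrt (INR n)) by (apply sqrt_lt_R0, lt_0_INR; lia).
    apply (filterlim_comp _ _ _ (fun v => sqrt (INR n) * Phi (sqrt (INR n) * sqrt (- ln v)))
             Ropp _ (locally (sqrt (INR n) * (2 * sqrt PI))));
      [|apply (filterlim_opp (V := R_NormedModule))].
    apply (filterlim_comp _ _ _ (fun v => Phi (sqrt (INR n) * sqrt (- ln v)))
             (fun y => sqrt (INR n) * y) _ (locally (2 * sqrt PI)));
      [|apply (filterlim_scal_r (V := R_NormedModule) (sqrt (INR n)))].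
    apply (filterlim_comp _ _ _ (fun v => sqrt (INR n) * sqrt (- ln v)) Phi
             _ (Rbar_locally p_infty)); [|exact is_lim_Phi].
    intros P [M HM]. set (r := sqrt (INR n)) in *.
    (* v < exp(-m^2) forces sqrt (- ln v) > m; take m >= 0 with r m >= M *)
    exists (mkposreal _ (exp_pos (- ((Rmax M 0 / r) * (Rmax M 0 / r)) - 1))).
    intros v Hv Hv0. apply HM.
    change (Rabs (v - 0) < exp (- (Rmax M 0 / r * (Rmax M 0 / r)) - 1)) in Hv.
    rewrite Rminus_0_r, Rabs_pos_eq in Hv by lra.
    apply ln_increasing in Hv; [|exact Hv0]. rewrite ln_exp in Hv.
    assert (Hm : 0 <= Rmax M 0 / r) by (apply Rdiv_le_0_compat; [apply Rmax_r|exact Hr]).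
    assert (Hlt : Rmax M 0 / r < sqrt (- ln v)).
    { rewrite <- (sqrt_square (Rmax M 0 / r)) by exact Hm. apply sqrt_lt_1_alt. nra. }
    apply (Rmult_lt_compat_l r) in Hlt; [|exact Hr].
    replace (r * (Rmax M 0 / r)) with (Rmax M 0) in Hlt by (field; lra).
    generalize (Rmax_l M 0). lra.
Qed.

(** * Series, limits and integrals *)

(** Weierstrass M-test.  The partial sums are Cauchy for the uniform distance,
    so they converge uniformly, and the uniform limit is the pointwise one. *)
Lemma uniform_cv_series {T : Type} {K : AbsRing} {V : CompleteNormedModule K}
  (u : nat -> T -> V) (S : T -> V) (M : nat -> R) :
  (forall n t, norm (u n t) <= M n) -> ex_series M ->
  (forall t, is_series (fun n => u n t) (S t)) ->
  filterlim (fun N t => sum_n (fun n => u n t) N) eventually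
    (locally (S : fct_UniformSpace T V)).
Proof.
  intros Hu HM HS.
  set (f := fun N t => sum_n (fun n => u n t) N).
  assert (Hc : exists y : @fct_CompleteSpace T V, filterlim f eventually (locally y)).
  { apply (filterlim_locally_cauchy (U := @fct_CompleteSpace T V) f).
    intros eps.
    destruct (Cauchy_ex_series (V := R_CompleteNormedModule) _ HM eps) as [N HN].
    exists (fun n => (N <= n)%nat). split; [exists N; auto|].
    assert (Hle : forall p q, (N <= p)%nat -> (p <= q)%nat ->
                    forall t, ball (f p t) eps (f q t)).
    { intros p q Hp Hq t. apply (norm_compat1 (V := V)). unfold f.
      replace (minus _ _) with (sum_n_m (fun n => u n t) (Datatypes.S p) q)
        by (apply (sum_n_m_sum_n (G := V)); exact Hq).
      eapply Rle_lt_trans; [apply (norm_sum_n_m (V := V) (fun n => u n t))|].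
      eapply Rle_lt_trans; [apply (sum_n_m_le _ M); intros k; apply Hu|].
      eapply Rle_lt_trans; [apply Rle_abs|]. apply (HN (Datatypes.S p) q); lia. }
    intros p q Hp Hq. destruct (Nat.le_ge_cases p q) as [h|h].
    - intros t. apply Hle; assumption.
    - intros t. apply ball_sym, Hle; assumption. }
  destruct Hc as [y Hy].
  replace (S : fct_UniformSpace T V) with (y : fct_UniformSpace T V); [exact Hy|].
  apply functional_extensionality; intros t.
  apply (filterlim_locally_unique (V := V) (F := eventually) (fun N => f N t)); [|apply HS].
  apply filterlim_locally. intros eps.
  assert (H := proj1 (filterlim_locally (U := fct_UniformSpace T V) f y) Hy eps).
  revert H. apply filter_imp. intros N HN. apply HN.
Qed.

Lemma is_RInt_sum_n {V : NormedModule R_AbsRing} (f : nat -> R -> V) (I : nat -> V)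
  (a b : R) (N : nat) :
  (forall n, is_RInt (f n) a b (I n)) ->
  is_RInt (fun v => sum_n (fun n => f n v) N) a b (sum_n I N).
Proof.
  intros H. induction N as [|N IH].
  - rewrite sum_O. apply (is_RInt_ext (f 0%nat)); [|apply H].
    intros v _. rewrite sum_O. reflexivity.
  - rewrite sum_Sn.
    apply (is_RInt_ext (fun v => plus (sum_n (fun n => f n v) N) (f (S N) v))).
    + intros v _. rewrite sum_Sn. reflexivity.
    + apply is_RInt_plus; [exact IH|apply H].
Qed.

Lemma filterlim_sum_n {T : Type} {K : AbsRing} {V : NormedModule K}
  {F : (T -> Prop) -> Prop} {FF : Filter F} (u : nat -> T -> V) (l : nat -> V) (N : nat) :
  (forall n, filterlim (u n) F (locally (l n))) ->
  filterlim (fun t => sum_n (fun n => u n t) N) F (locally (sum_n l N)).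
Proof.
  intros H. induction N as [|N IH].
  - rewrite sum_O. apply (filterlim_ext (u 0%nat)); [|apply H].
    intros t. rewrite sum_O. reflexivity.
  - rewrite sum_Sn.
    apply (filterlim_ext (fun t => plus (sum_n (fun n => u n t) N) (u (S N) t))).
    + intros t. rewrite sum_Sn. reflexivity.
    + apply (filterlim_comp_2 (G := locally (sum_n l N)) (H := locally (l (S N))) _ _ plus).
      * exact IH.
      * apply H.
      * apply (filterlim_plus (V := V)).
Qed.

(** * Exchanging the sum and the integral *)

Lemma B0_term_scale (x : C) (v : R) (n : nat) :
  B0_term (x * RtoC v) n = (RtoC (v ^ n) * B0_term x n)%C.
Proof.
  unfold B0_term. rewrite Cpow_mult_l, RtoC_pow. unfold Cdiv. ring.
Qed.

Lemma Cmod_B0_term (x : C) (n : nat) :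
  Cmod (B0_term x n) = Cmod x ^ n / (INR (fact n) * INR (fact n)).
Proof.
  assert (Hf := INR_fact_lt_0 n).
  assert (Hp : 0 < INR (fact n) * INR (fact n)) by nra.
  unfold B0_term.
  rewrite Cmod_div by (intros E; apply RtoC_inj in E; lra).
  rewrite Cmod_R, Rabs_pos_eq, Cmod_pow by lra. reflexivity.
Qed.

Lemma sqrt_INR_le_fact (n : nat) : sqrt (INR n) <= INR (fact n).
Proof.
  apply Rle_trans with (INR n).
  - destruct n as [|n].
    + simpl. rewrite sqrt_0. lra.
    + assert (H : 1 <= INR (S n)) by (rewrite S_INR; generalize (pos_INR n); lra).
      rewrite <- (sqrt_square (INR (S n))) at 2 by lra. apply sqrt_le_1_alt. nra.
  - apply le_INR. induction n as [|n IH]; [simpl; lia|].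
    simpl. generalize (lt_O_fact n). nia.
Qed.

Lemma ex_series_exp_bound (K y : R) : ex_series (fun n => K * (y ^ n / INR (fact n))).
Proof.
  apply (ex_series_scal (K := R_AbsRing) (V := R_NormedModule) K).
  exists (exp y). generalize (is_exp_Reals y). apply is_series_ext.
  intros n. rewrite pow_n_pow. unfold scal; simpl; unfold mult; simpl. reflexivity.
Qed.

(** One factorial absorbs sqrt n, and the other leaves an exponential series. *)
Lemma Cmod_B0_term_sqrt (x : C) (n : nat) :
  sqrt (INR n) * Cmod (B0_term x n) <= Cmod x ^ n / INR (fact n).
Proof.
  rewrite Cmod_B0_term. assert (Hf := INR_fact_lt_0 n).
  assert (H := sqrt_INR_le_fact n). assert (Hx : 0 <= Cmod x ^ n) by apply pow_le, Cmod_ge_0.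
  replace (Cmod x ^ n / INR (fact n))
    with (INR (fact n) * (Cmod x ^ n / (INR (fact n) * INR (fact n)))) by (field; lra).
  apply Rmult_le_compat_r; [|exact H]. apply Rdiv_le_0_compat; nra.
Qed.

Lemma Cmod_B0_term_le (x : C) (n : nat) :
  Cmod (B0_term x n) <= Cmod x ^ n / INR (fact n).
Proof.
  rewrite Cmod_B0_term. assert (Hf := INR_fact_lt_0 n).
  assert (Hx : 0 <= Cmod x ^ n) by apply pow_le, Cmod_ge_0.
  apply Rmult_le_compat_l; [exact Hx|]. apply Rinv_le_contravar; [exact Hf|].
  assert (H1 : 1 <= INR (fact n)) by (apply (le_INR 1), lt_O_fact). nra.
Qed.

Lemma RtoC_mult_scal (r : R) (c : C) :
  (RtoC r * c)%C = scal (V := C_R_CompleteNormedModule) r c.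
Proof.
  change ((RtoC r * c)%C = (r * fst c, r * snd c)).
  apply injective_projections; simpl; ring.
Qed.

Lemma is_RInt_integrand_term (x : C) (n : nat) (a b : R) :
  0 < a -> a <= b -> b < 1 ->
  is_RInt (V := C_R_CompleteNormedModule)
    (fun v => (RtoC ((1 - v ^ n) / weight v) * B0_term x n)%C) a b
    (RtoC (prim n b - prim n a) * B0_term x n)%C.
Proof.
  intros Ha Hab Hb.
  replace (RtoC (prim n b - prim n a) * B0_term x n)%C with
    (minus (G := C_R_CompleteNormedModule)
      (scal (V := C_R_CompleteNormedModule) (prim n b) (B0_term x n))
      (scal (V := C_R_CompleteNormedModule) (prim n a) (B0_term x n))).
  - apply (is_RInt_ext (V := C_R_CompleteNormedModule)
      (fun v => scal (V := C_R_CompleteNormedModule)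
                  ((1 - v ^ n) / weight v) (B0_term x n))).
    { intros v _. symmetry. apply RtoC_mult_scal. }
    apply (is_RInt_derive (V := C_R_CompleteNormedModule)
      (fun v => scal (V := C_R_CompleteNormedModule) (prim n v) (B0_term x n))).
    + rewrite Rmin_left, Rmax_right by exact Hab. intros v Hv.
      apply (is_derive_scal_l (V := C_R_CompleteNormedModule) (prim n)).
      apply is_derive_prim. lra.
    + rewrite Rmin_left, Rmax_right by exact Hab. intros v Hv.
      apply (continuous_scal (V := C_R_CompleteNormedModule)); [|apply continuous_const].
      apply (ex_derive_continuous (V := R_NormedModule)).
      unfold weight, Rpower. auto_derive.
      assert (Hl : ln v < 0) by (rewrite <- ln_1; apply ln_increasing; lra).
      repeat split; try lra. apply Rgt_not_eq, Rmult_lt_0_compat; [lra|apply exp_pos].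
  - rewrite <- !RtoC_mult_scal. rewrite RtoC_minus.
    change (RtoC (prim n b) * B0_term x n - RtoC (prim n a) * B0_term x n
            = (RtoC (prim n b) - RtoC (prim n a)) * B0_term x n)%C. ring.
Qed.

Lemma weight_pos (v : R) : 0 < v -> 0 < weight v.
Proof. intros Hv. apply Rmult_lt_0_compat; [exact Hv|apply exp_pos]. Qed.

Lemma is_series_integrand (x : C) (v : R) : 0 < v ->
  is_series (fun n => (RtoC ((1 - v ^ n) / weight v) * B0_term x n)%C) (integrand x v).
Proof.
  intros Hv. assert (Hw := weight_pos v Hv).
  assert (H := is_series_scal (K := C_AbsRing) (V := C_NormedModule) (/ RtoC (weight v))%C _ _
    (is_series_minus (K := C_AbsRing) (V := C_NormedModule) _ _ _ _
       (is_series_B0 x) (is_series_B0 (x * RtoC v)))).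
  replace (integrand x v) with
    (scal (K := C_AbsRing) (V := C_NormedModule) (/ RtoC (weight v))%C
       (minus (G := C_NormedModule) (B0 x) (B0 (x * RtoC v)))).
  - revert H. apply is_series_ext. intros n. rewrite B0_term_scale.
    rewrite Rdiv_def, RtoC_mult, RtoC_minus, RtoC_inv by lra.
    change (/ weight v * (B0_term x n - RtoC (v ^ n) * B0_term x n)
            = (1 - RtoC (v ^ n)) * / weight v * B0_term x n)%C. ring.
  - change (/ RtoC (weight v) * (B0 x - B0 (x * v)) = integrand x v)%C.
    unfold integrand, Cdiv. apply Cmult_comm.
Qed.

Lemma weight_ge (a b v : R) : 0 < a -> a <= v <= b -> b < 1 ->
  a * Rpower (- ln b) (3 / 2) <= weight v.
Proof.
  intros Ha Hv Hb. unfold weight.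
  assert (Hl : ln b < 0) by (rewrite <- ln_1; apply ln_increasing; lra).
  assert (Hl' : ln v <= ln b) by (apply ln_le; lra).
  apply Rmult_le_compat; [lra|apply Rlt_le, exp_pos|lra|].
  apply Rle_Rpower_l; lra.
Qed.

(** Integration of a uniformly convergent series.  Uniform convergence on the
    type R is required, so the terms are first replaced by 0 outside [a,b]. *)
Lemma is_RInt_integrand (x : C) (a b : R) : 0 < a -> a <= b -> b < 1 ->
  exists I : C,
    is_series (fun n => (RtoC (prim n b - prim n a) * B0_term x n)%C) I /\
    is_RInt (V := C_R_CompleteNormedModule) (integrand x) a b I.
Proof.
  intros Ha Hab Hb.
  set (inside := fun v => if Rle_dec a v then if Rle_dec v b then true else false else false).
  assert (Hin : forall v, inside v = true -> a <= v <= b).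
  { intros v. unfold inside. destruct (Rle_dec a v), (Rle_dec v b); easy. }
  assert (Hin' : forall v, a < v < b -> inside v = true).
  { intros v Hv. unfold inside. destruct (Rle_dec a v), (Rle_dec v b); auto; lra. }
  set (u := fun n v => if inside v
              then (RtoC ((1 - v ^ n) / weight v) * B0_term x n)%C else RtoC 0).
  set (g := fun v => if inside v then integrand x v else RtoC 0).
  set (w := a * Rpower (- ln b) (3 / 2)).
  assert (Hw : 0 < w) by (apply Rmult_lt_0_compat; [exact Ha|apply exp_pos]).
  assert (Hu : filterlim (fun N v => sum_n (G := C_NormedModule) (fun n => u n v) N)
                 eventually (locally (g : fct_UniformSpace R C_CompleteNormedModule))).
  { apply (uniform_cv_series (V := C_CompleteNormedModule) u g
             (fun n => / w * (Cmod x ^ n / INR (fact n)))).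
    - intros n v. change (Cmod (u n v) <= / w * (Cmod x ^ n / INR (fact n))).
      unfold u. destruct (inside v) eqn:E.
      + apply Hin in E. assert (H := weight_ge a b v Ha E Hb). fold w in H.
        rewrite Cmod_mult, Cmod_R.
        apply Rmult_le_compat; [apply Rabs_pos|apply Cmod_ge_0| |apply Cmod_B0_term_le].
        assert (Hp : 0 <= v ^ n <= 1).
        { split; [apply pow_le; lra|]. rewrite <- (pow1 n). apply pow_incr. lra. }
        rewrite Rabs_pos_eq by (apply Rdiv_le_0_compat; lra).
        rewrite <- (Rmult_1_l (/ w)).
        apply Rmult_le_compat; [lra|apply Rlt_le, Rinv_0_lt_compat; lra|lra|].
        apply Rinv_le_contravar; lra.
      + rewrite Cmod_0. apply Rmult_le_pos; [apply Rlt_le, Rinv_0_lt_compat, Hw|].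
        apply Rdiv_le_0_compat; [apply pow_le, Cmod_ge_0|apply INR_fact_lt_0].
    - apply ex_series_exp_bound.
    - intros v. unfold u, g. destruct (inside v) eqn:E.
      + apply Hin in E. apply is_series_integrand. lra.
      + apply (filterlim_ext (fun _ : nat => RtoC 0)); [|apply filterlim_const].
        intros N. symmetry. apply (sum_n_m_const_zero (G := C_NormedModule)). }
  destruct (filterlim_RInt (V := C_R_CompleteNormedModule)
    (fun N v => sum_n (G := C_NormedModule) (fun n => u n v) N) a b eventually _ g
    (fun N => sum_n (G := C_NormedModule)
                (fun n => (RtoC (prim n b - prim n a) * B0_term x n)%C) N)) as [I [HI HR]].
  - intros N. apply (is_RInt_sum_n (V := C_R_CompleteNormedModule) u).
    intros n. apply (is_RInt_ext (V := C_R_CompleteNormedModule)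
      (fun v => (RtoC ((1 - v ^ n) / weight v) * B0_term x n)%C)).
    + rewrite Rmin_left, Rmax_right by exact Hab. intros v Hv.
      unfold u. rewrite Hin' by exact Hv. reflexivity.
    + apply is_RInt_integrand_term; assumption.
  - exact Hu.
  - exists I. split; [exact HI|].
    apply (is_RInt_ext (V := C_R_CompleteNormedModule) g); [|exact HR].
    rewrite Rmin_left, Rmax_right by exact Hab. intros v Hv.
    unfold g. rewrite Hin' by exact Hv. reflexivity.
Qed.

(** Tannery's theorem: the integrals from a to b form a series dominated,
    uniformly in a and b, by an exponential series, so its limit may be taken
    termwise. *)
Lemma is_RInt_gen_integrand (x : C) :
  exists L : C,
    is_series (fun n => (RtoC (sqrt (INR n) * (2 * sqrt PI)) * B0_term x n)%C) L /\
    is_RInt_gen (V := C_R_CompleteNormedModule) (integrand x) (at_right 0) (at_left 1) L.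
Proof.
  set (u := fun n (ab : R * R) =>
              (RtoC (prim n (snd ab) - prim n (fst ab)) * B0_term x n)%C).
  set (K := 2 * (2 * sqrt PI + 2)).
  set (M := fun n => K * (Cmod x ^ n / INR (fact n))).
  assert (HM : forall n ab, Cmod (u n ab) <= M n).
  { intros n ab. unfold u, M. rewrite Cmod_mult, Cmod_R.
    assert (HK : 0 <= K) by (unfold K; generalize (sqrt_pos PI); lra).
    apply Rle_trans with (K * (sqrt (INR n) * Cmod (B0_term x n))).
    - rewrite <- Rmult_assoc. apply Rmult_le_compat_r; [apply Cmod_ge_0|].
      eapply Rle_trans; [apply Rabs_triang|]. rewrite Rabs_Ropp.
      assert (H1 := prim_bound n (snd ab)). assert (H2 := prim_bound n (fst ab)).
      unfold K. lra.
    - apply Rmult_le_compat_l; [exact HK|apply Cmod_B0_term_sqrt]. }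
  assert (Hs : forall ab, is_series (fun n => u n ab) (CSeries (fun n => u n ab))).
  { intros ab. destruct (ex_series_le (K := C_AbsRing) (V := C_CompleteNormedModule)
      (fun n => u n ab) M) as [l Hl].
    - intros n. apply HM.
    - apply ex_series_exp_bound.
    - rewrite (CSeries_unique _ _ Hl). exact Hl. }
  destruct (filterlim_switch (U := C_CompleteNormedModule) eventually _
    (filter_prod (at_right 0) (at_left 1)) _
    (fun N ab => sum_n (G := C_NormedModule) (fun n => u n ab) N)
    (fun ab => CSeries (fun n => u n ab))
    (fun N => sum_n (G := C_NormedModule)
       (fun n => (RtoC (sqrt (INR n) * (2 * sqrt PI)) * B0_term x n)%C) N)) as [L [HL HS]].
  - apply (uniform_cv_series (V := C_CompleteNormedModule) u _ M HM);
      [apply ex_series_exp_bound|exact Hs].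
  - intros N. apply (filterlim_sum_n (V := C_R_CompleteNormedModule) u). intros n.
    rewrite RtoC_mult_scal.
    apply (filterlim_ext (fun ab => scal (V := C_R_CompleteNormedModule)
             (prim n (snd ab) - prim n (fst ab)) (B0_term x n))).
    { intros ab. symmetry. apply RtoC_mult_scal. }
    apply (filterlim_comp _ _ _ (fun ab : R * R => prim n (snd ab) - prim n (fst ab))
             (fun r => scal (V := C_R_CompleteNormedModule) r (B0_term x n))
             _ (locally (sqrt (INR n) * (2 * sqrt PI))));
      [|apply (filterlim_scal_l (V := C_R_CompleteNormedModule))].
    replace (sqrt (INR n) * (2 * sqrt PI))
      with (plus 0 (opp (- (sqrt (INR n) * (2 * sqrt PI)))))
      by (unfold plus, opp; simpl; ring).
    apply (filterlim_comp_2 (G := locally 0)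
             (H := locally (opp (- (sqrt (INR n) * (2 * sqrt PI)))))
             (fun ab : R * R => prim n (snd ab)) (fun ab : R * R => opp (prim n (fst ab))) plus).
    + apply (filterlim_comp _ _ _ snd (prim n) _ (at_left 1));
        [apply filterlim_snd|apply filterlim_prim_1].
    + apply (filterlim_comp _ _ _ fst (fun a => opp (prim n a)) _ (at_right 0));
        [apply filterlim_fst|].
      apply (filterlim_comp _ _ _ (prim n) opp
               _ (locally (- (sqrt (INR n) * (2 * sqrt PI))))).
      * apply filterlim_prim_0.
      * apply (filterlim_opp (V := R_NormedModule)).
    + apply (filterlim_plus (V := R_NormedModule)).
  - exists L. split; [exact HL|].
    apply (filterlimi_lim_ext_loc (fun ab => CSeries (fun n => u n ab))); [|exact HS].
    exists (fun a => 0 < a < / 2) (fun b => / 2 < b < 1).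
    + assert (H2 : 0 < / 2) by lra. exists (mkposreal _ H2).
      intros a Ha Ha0. change (Rabs (a - 0) < / 2) in Ha. apply Rabs_def2 in Ha. lra.
    + assert (H2 : 0 < / 2) by lra. exists (mkposreal _ H2).
      intros b Hb Hb1. change (Rabs (b - 1) < / 2) in Hb. apply Rabs_def2 in Hb. lra.
    + intros a b Ha Hb. simpl.
      destruct (is_RInt_integrand x a b) as [I [HI HR]]; try lra.
      unfold u; simpl. rewrite (CSeries_unique _ _ HI). exact HR.
Qed.

(* The first two conjuncts say that the series and the integral (improper at
   both ends, for C as a real Banach space) converge. *)
Theorem corollary23 (x : C) :
  ex_series (sqrt_term x) /\
  ex_RInt_gen (V := C_R_CompleteNormedModule)
    (integrand x) (at_right 0) (at_left 1) /\
  CSeries (sqrt_term x) =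
    (RtoC (1 / (2 * sqrt PI)) *
     RInt_gen (V := C_R_CompleteNormedModule)
       (integrand x) (at_right 0) (at_left 1))%C.
Proof.
  destruct (is_RInt_gen_integrand x) as [L [HL HI]].
  assert (Hpi : 0 < sqrt PI) by apply sqrt_lt_R0, PI_RGT_0.
  assert (Hs : is_series (sqrt_term x) (RtoC (1 / (2 * sqrt PI)) * L)%C).
  { assert (H := is_series_scal (K := C_AbsRing) (V := C_NormedModule)
                   (RtoC (1 / (2 * sqrt PI))) _ _ HL).
    revert H. apply is_series_ext. intros n.
    change (RtoC (1 / (2 * sqrt PI)) *
              (RtoC (sqrt (INR n) * (2 * sqrt PI)) * B0_term x n) = sqrt_term x n)%C.
    rewrite Cmult_assoc, <- RtoC_mult.
    replace (1 / (2 * sqrt PI) * (sqrt (INR n) * (2 * sqrt PI)))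
      with (sqrt (INR n)) by (field; lra).
    unfold sqrt_term, B0_term. assert (Hf := INR_fact_lt_0 n).
    rewrite RtoC_div, RtoC_mult by lra. field.
    intros E. apply RtoC_inj in E. lra. }
  split; [eexists; exact Hs|]. split; [exists L; exact HI|].
  rewrite (CSeries_unique _ _ Hs).
  rewrite (is_RInt_gen_unique (V := C_R_CompleteNormedModule) _ _ HI). reflexivity.
Qed.
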